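(* Let $G$ be a graph on $n$ vertices, and suppose $G$ has only even cycles. Then the rank of $G$ is equal to the rank of a spanning tree. In particular, $\operatorname{rank}(J_G)=n-1$.
   Context: Graphs are finite and simple. A $3$-colored graph is a graph $G=(V,E)$ together with a color function $\gamma:V\to\{1,-1,0\}$; a vertex $v$ is colorless if $\gamma(v)=0$ and colored otherwise. For $V=\{1,\dots,n\}$ and $\mathbf e_j$ the $j$th standard row vector of $\mathbb R^n$, the c-incidence matrix $J_G$ is the real $(|E|+n)\times n$ matrix whose first $|E|$ rows are $\mathbf e_i+\mathbf e_j$, one for each edge $\{i,j\}\in E$ (the transpose of the unsigned incidence matrix), and whose last $n$ rows are $\gamma(i)\mathbf e_i$. If $G$ is not colored, these last $n$ rows are zero, and the rank of $J_G$ is the rank of the incidence matrix. The rank of $G$ is the rank of $J_G$ over $\mathbb R$.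
   Formalization: G is assumed connected and not colored: a disconnected graph has no spanning tree (two isolated vertices have rank 0, not n-1 = 1), and a connected graph with only even cycles and a colored vertex has rank n. *)

(* Defs.v *)
From mathcomp Require Import all_boot all_order all_algebra.

Set Implicit Arguments.
Unset Strict Implicit.
Unset Printing Implicit Defensive.

Import GRing.Theory.
Local Open Scope ring_scope.

(* Vertices 1, ..., n are represented by 'I_n. An edge is its two-element set
   of endpoints, so loops and multiple edges are excluded. *)
Record cgraph (n : nat) : Type := CGraph {
  edges : {set {set 'I_n}};
  color : 'I_n -> int;
  edges_card2 : forall e, e \in edges -> #|e| = 2%N;
  color_values : forall v, color v \in [:: 1; -1; 0]
}.

Section Graphs.
Variables (n : nat) (G : cgraph n).

Definition adj : rel 'I_n := fun u v => [set u; v] \in edges G.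

Definition colorless (v : 'I_n) : Prop := color G v = 0.

Definition uncolored : Prop := forall v, colorless v.

(* The length of the cycle is size c; the condition 2 < size c rules out
   traversing a single edge back and forth. *)
Definition graph_cycle (c : seq 'I_n) : bool :=
  [&& (2 < size c)%N, cycle adj c & uniq c].

Definition only_even_cycles : Prop :=
  forall c, graph_cycle c -> ~~ odd (size c).

Definition acyclic : Prop := forall c, ~~ graph_cycle c.

(* The graph with no vertex is not connected. *)
Definition connected_graph : Prop :=
  (0 < n)%N /\ forall u v, connect adj u v.

Definition is_tree : Prop := connected_graph /\ acyclic.

(* The row of an edge {i, j} is e_i + e_j; the edges are listed in the order
   given by enum. *)
Definition edge_rows (R : fieldType) : 'M[R]_(#|edges G|, n) :=
  \matrix_(k < #|edges G|) \sum_(i in (enum_val k : {set 'I_n})) delta_mx 0 i.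

Definition color_rows (R : fieldType) : 'M[R]_n :=
  \matrix_(i < n) ((color G i)%:~R *: delta_mx 0 i).

Definition c_incidence (R : fieldType) : 'M[R]_(#|edges G| + n, n) :=
  col_mx (edge_rows R) (color_rows R).

Definition graph_rank (R : fieldType) : nat := \rank (c_incidence R).

End Graphs.

(* T has the same vertex set as G by typing, and inherits its colors. *)
Definition spanning_tree (n : nat) (G T : cgraph n) : Prop :=
  [/\ edges T \subset edges G, (forall v, color T v = color G v) & is_tree T].

(* Main.v *)
(* A vector x in the kernel of J_G satisfies x_i + x_j = 0 on every edge, so on
   a connected graph it is determined by one entry. An odd closed walk contains
   an odd cycle, hence a connected graph with only even cycles is 2-colorable,
   and the signs of a 2-coloring span the kernel. Deleting edges that lie on
   cycles leaves a spanning tree, which is again a connected uncolored graph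
   with only even cycles, so it has the same rank. *)
Require Import Defs.
From mathcomp Require Import all_boot all_order all_algebra.
From mathcomp Require Import reals.

Set Implicit Arguments.
Unset Strict Implicit.
Unset Printing Implicit Defensive.

Import GRing.Theory Num.Theory.
Local Open Scope ring_scope.

Lemma not_uniq_split (T : eqType) (s : seq T) :
  ~~ uniq s -> exists x p1 p2 p3, s = p1 ++ x :: p2 ++ x :: p3.
Proof.
elim: s => //= x s IHs; rewrite negb_and negbK.
case: (boolP (x \in s)) => [/splitPr [p2 p3] _ | _ /= /IHs].
  by exists x, [::], p2, p3.
by case=> y [p1 [p2 [p3 ->]]]; exists y, (x :: p1), p2, p3.
Qed.

Section Walks.
Variables (n : nat) (G : cgraph n).

Lemma adj_sym : symmetric (adj G).
Proof. by move=> u v; rewrite /adj setUC. Qed.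

Lemma adj_irr : irreflexive (adj G).
Proof. by move=> u; apply/negP => /edges_card2; rewrite setUid cards1. Qed.

(* A closed walk with a repeated vertex splits there into two shorter closed
   walks, one of which is odd. *)
Lemma odd_closed_walk (c : seq 'I_n) :
  cycle (adj G) c -> odd (size c) ->
  exists2 d, graph_cycle G d & odd (size d).
Proof.
have [m] := ubnP (size c); elim: m c => // m IHm c lt_c_m cyc_c odd_c.
have [uniq_c | /not_uniq_split] := boolP (uniq c).
  exists c; rewrite // /graph_cycle cyc_c uniq_c andbT.
  (* An odd closed walk of size below 3 would be a single vertex, that is, a loop. *)
  by case: c cyc_c odd_c {lt_c_m uniq_c} => [|x [|y [|z c]]] //=; rewrite adj_irr.
case=> x [p1 [p2 [p3 def_c]]].
(* After this rotation both pieces start at [x], and each closes up at [x]. *)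
have {def_c} : rot (size p1) c = (x :: p2) ++ x :: (p3 ++ p1).
  by rewrite def_c rot_size_cat /= -catA.
set d1 := x :: p2; set d2 := x :: _ => def_d.
have sz_c : size c = (size d1 + size d2)%N.
  by rewrite -(size_rot (size p1)) def_d size_cat.
have /andP[cyc1 cyc2] : cycle (adj G) d1 && cycle (adj G) d2.
  move: cyc_c; rewrite -(rot_cycle (size p1)) def_d /= rcons_cat cat_path /=.
  by rewrite !rcons_path => /and3P[-> -> ].
move: odd_c lt_c_m; rewrite sz_c oddD ltnS => odd_c le_m.
case: (boolP (odd (size d1))) odd_c => [odd1 _ | _ /= odd2].
  by apply: (IHm d1) => //; apply: leq_trans le_m; rewrite -addn1 leq_add2l.
by apply: (IHm d2) => //; apply: leq_trans le_m; rewrite -add1n leq_add2r.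
Qed.

(** Each vertex gets the parity of a chosen walk from a root [r]. An edge between two vertices of
    equal parity would close their walks into an odd closed walk. *)
Lemma even_cycles_two_coloring :
  connected_graph G -> only_even_cycles G ->
  exists s : 'I_n -> bool, forall u v, adj G u v -> s u = ~~ s v.
Proof.
case=> n_gt0 conn even; pose r := Ordinal n_gt0.
have [p] : exists p : 'I_n -> seq 'I_n, forall v,
      path (adj G) r (p v) /\ v = last r (p v).
  apply: (@fin_all_exists _ _ (fun v q => path (adj G) r q /\ v = last r q)) => v.
  by have /connectP[q] := conn r v; exists q.
move=> walk; exists (fun v => odd (size (p v))) => u v uv.
have [pu def_u] := walk u; have [pv def_v] := walk v.
apply/eqP/negPn/negP => same_parity.
(* Out from [r] to [u], across to [v], then back along the walk to [v]. The start [r] is listed only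
   at the end, so the size is that of both walks plus one. *)
pose c := p u ++ v :: rev (belast r (p v)).
have last_c : last r c = r.
  rewrite last_cat /=; case: (p v) def_v => [|x q] //= _.
  by rewrite rev_cons last_rcons.
have cyc_c : cycle (adj G) c.
  rewrite (cycle_path r) last_c cat_path pu /= -def_u uv /= {1}def_v rev_path.
  by rewrite (eq_path (e' := adj G)) // => x y; rewrite adj_sym.
have /(odd_closed_walk cyc_c) [d /even/negP] : odd (size c) => //.
rewrite size_cat /= size_rev size_belast addnS /= oddD.
by case: (odd _) (odd _) same_parity => [] [].
Qed.

Definition delete_edge (e : {set 'I_n}) : cgraph n.
Proof.
apply: (@CGraph n (edges G :\ e) (color G)) => [f /setD1P[_]|].
  exact: edges_card2.
exact: color_values.
Defined.

(** The rest of the cycle still joins [y] to [x], so every walk using the deleted edge can be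
    rerouted. *)
Lemma connected_delete_cycle_edge (x y : 'I_n) (c : seq 'I_n) :
  graph_cycle G [:: x, y & c] -> connected_graph G ->
  connected_graph (delete_edge [set x; y]).
Proof.
case/and3P; rewrite /= rcons_path.
case: c => // z c _ /and3P[_ walk closing] /and3P[xNc yNc _] [n_gt0 conn].
split=> // u v; set e := adj (delete_edge _).
have eE a b : e a b = ([set a; b] != [set x; y]) && adj G a b.
  by rewrite /e /adj in_setD1.
have avoid a b w : w \in [set x; y] -> w != a -> w != b -> adj G a b -> e a b.
  move=> w_xy wNa wNb ab; rewrite eE ab andbT; apply/eqP => /setP/(_ w).
  by rewrite w_xy in_set2 (negPf wNa) (negPf wNb).
have e_sym : connect_sym e.
  by apply: sym_connect_sym => a b; rewrite !eE setUC adj_sym.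
have xy : connect e x y.
  rewrite e_sym; apply/connectP; exists (rcons (z :: c) x); rewrite ?last_rcons //.
  rewrite rcons_path; apply/andP; split.
    (* The steps from [y] through [z :: c] miss [x]; the closing step back to [x] misses [y],
       because [z :: c] is nonempty. *)
    apply: (sub_in_path (P := predC1 x) _ _ walk) => [a b|].
      rewrite !inE ![_ == x]eq_sym; apply: avoid; exact: set21.
    by apply/allP => a /=; apply: contraTneq => ->.
  apply: avoid closing; first exact: set22.
    by apply: contraNneq yNc => -> /=; apply: mem_last.
  by apply: contraNneq xNc => <-; rewrite mem_head.
apply: connect_sub (conn u v) => a b ab.
have [eq_ab | neq_ab] := eqVneq [set a; b] [set x; y]; last first.
  by apply: connect1; rewrite eE neq_ab.
have aNb : a != b by apply: contraTneq ab => ->; rewrite adj_irr.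
have: (a \in [set x; y]) && (b \in [set x; y]) by rewrite -eq_ab set21 set22.
rewrite !in_set2 => /andP[/orP[] /eqP def_a /orP[] /eqP def_b];
  by rewrite def_a def_b ?connect0 // e_sym.
Qed.

End Walks.

(** Induction on the number of edges: delete an edge whose removal keeps the graph connected. When
    there is none, no cycle can exist, since its first edge would be such an edge. *)
Lemma ex_spanning_tree (n : nat) (G : cgraph n) :
  connected_graph G -> exists T, spanning_tree G T.
Proof.
have [m] := ubnP #|edges G|; elim: m G => // m IHm G lt_G_m conn.
have [/exists_inP[e eG /forallP e_conn] | /exists_inPn no_e] :=
  boolP [exists e in edges G,
    [forall u, forall v, connect (adj (delete_edge G e)) u v]].
  have [||T [sTG colT treeT]] := IHm (delete_edge G e).
  - by move: lt_G_m; rewrite (cardsD1 e (edges G)) eG.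
  - by split=> [|u v]; [case: conn | move/forallP: (e_conn u)].
  by exists T; split=> //; apply: subset_trans sTG _; apply: subD1set.
exists G; split=> //; split=> // c; apply/negP => cyc.
case: c cyc => [|x [|y c]] // cyc.
have [_ [_ e_conn]] := (cyc, connected_delete_cycle_edge cyc conn).
have xy : adj G x y by case/and3P: cyc => _ /andP[].
by case/negP: (no_e _ xy); apply/forallP => u; apply/forallP.
Qed.

Section Rank.
Variables (R : numFieldType) (n : nat) (G : cgraph n).

(** [kermx] is a left kernel, hence the transpose. The color rows vanish, and each edge row pairs
    with [u] to the sum over its two endpoints. *)
Lemma ker_c_incidenceP (u : 'rV[R]_n) :
  uncolored G ->
  reflect (forall i j, adj G i j -> u 0 i + u 0 j = 0)
          (u <= kermx (c_incidence G R)^T)%MS.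
Proof.
move=> unc.
have color0 : color_rows G R = 0.
  by apply/row_matrixP => i; rewrite rowK unc scale0r row0.
have edgeE k : (u *m (edge_rows G R)^T) 0 k = \sum_(i in enum_val k) u 0 i.
  rewrite mxE; under eq_bigr => j _ do rewrite !mxE summxE mulr_sumr.
  rewrite exchange_big; apply: eq_bigr => i _ /=.
  rewrite (bigD1 i) //= big1 ?addr0 => [|j /negPf jNi]; rewrite mxE eqxx.
    by rewrite eqxx mulr1.
  by rewrite jNi mulr0.
have kerE : (u <= kermx (c_incidence G R)^T)%MS
          = (u *m (edge_rows G R)^T == 0).
  apply/sub_kermxP/eqP; rewrite tr_col_mx color0 trmx0 mul_mx_row mulmx0.
    by rewrite -[RHS]row_mx0 => /eq_row_mx[].
  by move=> ->; rewrite row_mx0.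
rewrite kerE; apply: (iffP eqP) => [/rowP u0 i j ij | u0].
  have iNj : i != j by apply: contraTneq ij => ->; rewrite adj_irr.
  have := u0 (enum_rank_in (ij : [set i; j] \in edges G) [set i; j]).
  by rewrite edgeE enum_rankK_in // big_setU1 ?in_set1 // big_set1 mxE.
apply/rowP => k; rewrite edgeE mxE; have kG := enum_valP k.
have /eqP/cards2P[i [j [iNj def_k]]] := edges_card2 kG.
by rewrite def_k big_setU1 ?in_set1 // big_set1 /= u0 // /adj -def_k.
Qed.

Lemma even_cycles_graph_rank :
  connected_graph G -> uncolored G -> only_even_cycles G ->
  graph_rank G R = (n - 1)%N.
Proof.
move=> conn unc even; have [s sP] := even_cycles_two_coloring conn even.
have [n_gt0 connG] := conn; pose r := Ordinal n_gt0.
pose w : 'rV[R]_n := \row_v (-1) ^+ s v.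
have w_ker : (w <= kermx (c_incidence G R)^T)%MS.
  apply/ker_c_incidenceP => // i j /sP; rewrite !mxE => ->.
  by rewrite signrN addNr.
have ker_w : (kermx (c_incidence G R)^T <= w)%MS.
  apply/rV_subP => u /ker_c_incidenceP-/(_ unc) u0.
  (* Across an edge both [u] and [w] change sign, so their product is constant along walks from
     [r]. *)
  have u_eq v : u 0 v * w 0 v = u 0 r * w 0 r.
    have /connectP[p] := connG r v.
    elim/last_ind: p v => [v _ -> // | p x IHp v].
    rewrite rcons_path last_rcons => /andP[path_p px] ->.
    rewrite -(IHp _ path_p erefl) !mxE (sP _ _ px) signrN mulrN -mulNr.
    by rewrite (addr0_eq (u0 _ _ px)).
  (* Entries of [w] square to 1, so multiplying [u_eq] by [w 0 v] recovers [u 0 v]. *)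
  apply/sub_rVP; exists (u 0 r * w 0 r); apply/rowP => v.
  by rewrite mxE -(u_eq v) -mulrA !mxE -expr2 sqrr_sign mulr1.
have w_neq0 : w != 0.
  by apply/eqP => /rowP/(_ r)/eqP; rewrite !mxE signr_eq0.
have : \rank (kermx (c_incidence G R)^T) = 1%N.
  by rewrite (eqmx_rank (B := w)) ?rank_rV ?w_neq0 // ker_w w_ker.
rewrite mxrank_ker mxrank_tr => rank_ker.
(* Subtraction is truncated; the double subtraction cancels because the rank is at most [n]. *)
by rewrite /graph_rank -rank_ker subKn // rank_leq_col.
Qed.

End Rank.

Theorem proposition2 (R : realType) (n : nat) (G : cgraph n)
  (G_connected : connected_graph G) (G_uncolored : uncolored G)
  (G_even : only_even_cycles G) :
  [/\ (exists T : cgraph n, spanning_tree G T),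
      (forall T : cgraph n, spanning_tree G T ->
         graph_rank G R = graph_rank T R)
    & \rank (c_incidence G R) = (n - 1)%N].
Proof.
split; first exact: ex_spanning_tree; last exact: even_cycles_graph_rank.
(* Both ranks equal [n - 1]: the tree inherits the zero colors, and its cycles are even
   vacuously. *)
move=> T [_ colT [connT acycT]]; rewrite !even_cycles_graph_rank //.
  by move=> v; rewrite /colorless colT; apply: G_uncolored.
by move=> c cyc; have := acycT c; rewrite cyc.
Qed.
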